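(* Let $n\ge 1$ and let $d$ be a positive integer with $d\le n$. The number of $d$-cycles in the graph $G(n,312)$ is $$\frac{1}{d}\sum_{e\mid d}\mu\!\left(\frac{d}{e}\right)\binom{2e}{e},$$ where the sum is over the positive divisors $e$ of $d$ and $\mu$ is the number-theoretic Möbius function.
   Context: For a sequence $x=x_1\cdots x_m$ of distinct real numbers, its standardization $\Pi(x)$ is the unique permutation $\pi\in\mathfrak S_m$ with $\pi_i<\pi_j \iff x_i<x_j$ for all $i,j$. A permutation $\pi\in\mathfrak S_m$ avoids $312$ if there are no indices $i<j<k$ with $\pi_j<\pi_k<\pi_i$; $\mathfrak S_m(312)$ denotes the set of such permutations. The graph $G(n,312)$ is the directed multigraph with vertex set $\mathfrak S_n(312)$ having, for each $\sigma=\sigma_1\cdots\sigma_{n+1}\in\mathfrak S_{n+1}(312)$, one directed edge labelled $\sigma$ from $\Pi(\sigma_1\cdots\sigma_n)$ (its tail) to $\Pi(\sigma_2\cdots\sigma_{n+1})$ (its head). A closed walk of length $d$ is a list of $d$ edges $(e_1,\dots,e_d)$ with $\mathrm{head}(e_i)=\mathrm{tail}(e_{i+1})$ for $1\le i\le d-1$ and $\mathrm{head}(e_d)=\mathrm{tail}(e_1)$; different cyclic shifts of a closed walk are considered different closed walks. Two closed walks are equivalent if one is a cyclic shift $(e_i,\dots,e_d,e_1,\dots,e_{i-1})$ of the other. A $d$-cycle is an equivalence class (of closed walks of length $d$) having exactly $d$ elements. *)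

(* Defs.v *)
From HB Require Import structures.
From mathcomp Require Import all_boot all_order all_fingroup all_algebra.
Set Implicit Arguments. Unset Strict Implicit. Unset Printing Implicit Defensive.

Definition word (m : nat) (p : {perm 'I_m}) : seq nat := [seq (p i : nat) | i <- enum 'I_m].

Definition std (s : seq nat) : seq nat := [seq count (fun y => y < x) s | x <- s].

Definition avoids312 (m : nat) (p : {perm 'I_m}) : bool :=
  ~~ [exists i : 'I_m, exists j : 'I_m, exists k : 'I_m,
        [&& i < j, j < k, p j < p k & p k < p i]].

(* Edge labelled sigma in G(n,312): tail = Pi(sigma_1..sigma_n),
   head = Pi(sigma_2..sigma_{n+1}) (as one-line words of S_n). *)
Definition etail (n : nat) (s : {perm 'I_n.+1}) : seq nat := std (take n (word s)).
Definition ehead (n : nat) (s : {perm 'I_n.+1}) : seq nat := std (drop 1 (word s)).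

Definition closed_walk (n d : nat) (w : d.-tuple {perm 'I_n.+1}) : bool :=
  all (@avoids312 n.+1) w &&
  [forall i : 'I_d,
     ehead (tnth w i) == etail (nth 1%g w (i.+1 %% d))].

Definition walk_class (n d : nat) (w : d.-tuple {perm 'I_n.+1})
  : {set d.-tuple {perm 'I_n.+1}} :=
  [set [tuple of rot i w] | i : 'I_d].

Definition d_cycles (n d : nat) : {set {set d.-tuple {perm 'I_n.+1}}} :=
  [set walk_class w | w in [pred w | closed_walk w && (#|walk_class w| == d)]].

(* Number-theoretic Moebius function (for n >= 1). *)
Definition moebius (n : nat) : int :=
  if all (fun p => logn p n == 1) (primes n) then ((-1) ^+ size (primes n))%R else 0%R.

(* Main.v *)
Require Import Defs.
From mathcomp Require Import all_boot all_order all_fingroup all_algebra.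
From mathcomp Require Import zify.
Import GRing.Theory.

(** A closed walk of length d, read backwards, is a d-periodic sequence of
windows.  312-avoidance says that the entries exceeding a given entry k inside
the window preceding it form a block adjacent to it, of length u k <= n; the
sequence u determines the walk, and the only condition on it is that the
blocks with u k < n are nested.  When d <= n periodicity forces u k < d or
u k = n, so n plays the role of infinity.

Let c k be the number of positions whose innermost enclosing block is the one
of k.  Each position has at most one innermost enclosing block, so the sum of c
over a period is at most d.  Conversely u k is the least t with
c k + ... + c (k + t) <= t (and n if no t < d works), and every c : N^d of sum at
most d occurs.  There are 'C(2d, d) such c, hence 'C(2d, d) closed walks.
Sorting closed walks by their minimal period e | d, Moebius inversion counts
the primitive ones, and each d-cycle consists of d of them. *)

Set Implicit Arguments. Unset Strict Implicit. Unset Printing Implicit Defensive.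

(** * Lattice codes *)

Definition psum (c : nat -> nat) (k t : nat) : nat := \sum_(i < t) c (k + i).

Lemma psum_add c k s t : psum c k (s + t) = psum c k s + psum c (k + s) t.
Proof.
rewrite /psum big_split_ord /=; congr (_ + _).
by apply: eq_bigr => i _; rewrite addnA.
Qed.

Lemma psum1 c k : psum c k 1 = c k.
Proof. by rewrite /psum big_ord1 addn0. Qed.

Lemma psumS c k t : psum c k t.+1 = psum c k t + c (k + t).
Proof. by rewrite -addn1 psum_add psum1. Qed.

Lemma psumSl c k t : psum c k t.+1 = c k + psum c k.+1 t.
Proof. by rewrite -add1n psum_add psum1 addn1. Qed.

Lemma eq_psum c c' k t :
  (forall i, i < t -> c (k + i) = c' (k + i)) -> psum c k t = psum c' k t.
Proof. by move=> h; apply: eq_bigr => i _; apply: h. Qed.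

Lemma psum_period d c : (forall k, c (k + d) = c k) ->
  forall k, psum c k d = psum c 0 d.
Proof.
move=> hp; elim=> [//|k IH]; rewrite -IH.
have := psumSl c k d; rewrite psumS hp; lia.
Qed.

(** First passage below its start of the path with steps [c i - 1] begun at [k]: after [t + 1] steps
    it is below exactly when [psum c k t.+1 <= t]. [find] returns [d] on failure, whence the
    test. *)
Definition ucode (n d : nat) (c : nat -> nat) (k : nat) : nat :=
  let t := find (fun t => psum c k t.+1 <= t) (iota 0 d) in
  if t < d then t else n.

Lemma eq_ucode n d c k k' : (forall i, c (k + i) = c (k' + i)) ->
  ucode n d c k = ucode n d c k'.
Proof.
move=> h; rewrite /ucode.
suff -> : find (fun t => psum c k t.+1 <= t) (iota 0 d)
        = find (fun t => psum c k' t.+1 <= t) (iota 0 d) by [].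
by apply: eq_find => t; rewrite /psum; under eq_bigr do rewrite h.
Qed.

Lemma ucode_lt n d c k s : s < d -> s < ucode n d c k -> s < psum c k s.+1.
Proof.
move=> sd; rewrite /ucode; set f := find _ _ => hs.
have sf : s < f.
  move: hs; case: ifP => //; lia.
have := before_find 0 sf; rewrite nth_iota // add0n; lia.
Qed.

Lemma ucode_le n d c k : d <= n -> ucode n d c k <= n.
Proof. by rewrite /ucode; case: ifP => //; lia. Qed.

Lemma ucode_fin n d c k : ucode n d c k < n -> ucode n d c k < d.
Proof. by rewrite /ucode; case: ifP => //; lia. Qed.

Lemma ucode_psum n d c k : d <= n -> ucode n d c k < d ->
  psum c k (ucode n d c k).+1 <= ucode n d c k.
Proof.
move=> dn; rewrite /ucode; case: ifP => [hf _|]; last by lia.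
have hh : has (fun t => psum c k t.+1 <= t) (iota 0 d) by rewrite has_find size_iota.
by have := nth_find 0 hh; rewrite nth_iota.
Qed.

Lemma ucode_ge n d c k s : s <= d -> s <= ucode n d c k -> s <= psum c k s.
Proof. by case: s => [//|s] sd su; apply: (ucode_lt sd su). Qed.

Lemma ucode_min n d c k s : s < d -> psum c k s.+1 <= s -> ucode n d c k <= s.
Proof. by move=> sd hs; rewrite leqNgt; apply/negP => /(ucode_lt sd); lia. Qed.

(** Each step [c i - 1] lowers the path by at most one, so its first passage lands exactly one unit
    below the start. *)
Lemma ucode_eq n d c k : d <= n -> ucode n d c k < d ->
  psum c k (ucode n d c k).+1 = ucode n d c k.
Proof.
move=> dn ud; have := ucode_psum dn ud; rewrite psumS.
have := @ucode_ge n d c k (ucode n d c k) (ltnW ud) (leqnn _); lia.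
Qed.

Definition nested (n : nat) (u : nat -> nat) : Prop :=
  forall k t, u k < n -> 0 < t <= u k -> t + u (k + t) <= u k.

(** At offset [t] the path from [k] is still not below its start, whereas at the end of the block it
    is one unit below. So the path from [k + t] has passed below its own start by then. *)
Lemma ucode_nested n d c : d <= n -> nested n (ucode n d c).
Proof.
move=> dn k t un /andP[t0 tu].
have ud := ucode_fin un.
have e := ucode_eq dn ud.
have ht := @ucode_ge n d c k t ltac:(lia) tu.
have tE : (ucode n d c k).+1 = t + (ucode n d c k - t).+1 by lia.
rewrite {1}tE psum_add in e.
have := @ucode_min n d c (k + t) (ucode n d c k - t) ltac:(lia) ltac:(lia); lia.
Qed.

(** By [ucode_eq], [c k] is the code at [k] minus the sum of [c] over the rest of the block.
    Positions there have strictly smaller codes by nestedness, so induction on the code value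
    applies. *)
Lemma ucode_inj_fin n d c c' : d <= n -> ucode n d c =1 ucode n d c' ->
  forall k, ucode n d c k < d -> c k = c' k.
Proof.
move=> dn uE k; move: {2}(ucode n d c k) (leqnn (ucode n d c k)) => m.
elim: m k => [|m IH] k um ud.
  have := ucode_eq dn ud; have := @ucode_eq n d c' k dn; rewrite -uE => /(_ ud).
  by rewrite (_ : ucode n d c k = 0) ?psum1; lia.
have := ucode_eq dn ud; have := @ucode_eq n d c' k dn; rewrite -uE => /(_ ud).
rewrite !psumSl.
suff -> : psum c k.+1 (ucode n d c k) = psum c' k.+1 (ucode n d c k) by lia.
apply: eq_psum => i iu; rewrite addSnnS.
have := @ucode_nested n d c dn k i.+1 ltac:(lia) ltac:(lia) => h.
by apply: IH; lia.
Qed.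

(** If the code at [k] is infinite, let [k + t] be the next such position. The stretches of lengths
    [t] and [d - t] sum to at least their lengths and together to at most [d], so the first sums to
    exactly [t]. The other entries of that stretch are known from [ucode_inj_fin]. *)
Lemma ucode_inj n d c c' : 0 < d -> d <= n ->
  (forall k, c (k + d) = c k) -> (forall k, c' (k + d) = c' k) ->
  psum c 0 d <= d -> psum c' 0 d <= d ->
  ucode n d c =1 ucode n d c' -> c =1 c'.
Proof.
move=> d0 dn pc pc' sc sc' uE k.
have [|du] := ltnP (ucode n d c k) d; first exact: ucode_inj_fin.
have hex : exists t, (0 < t) && (d <= ucode n d c (k + t)).
  exists d; rewrite d0 /=; suff -> : ucode n d c (k + d) = ucode n d c k by [].
  by apply: eq_ucode => i; rewrite addnAC pc.
have [t /andP[t0 tu] tmin] := ex_minnP hex.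
have td : t <= d.
  apply: tmin; rewrite d0 /=; suff -> : ucode n d c (k + d) = ucode n d c k by [].
  by apply: eq_ucode => i; rewrite addnAC pc.
have block c2 : ucode n d c =1 ucode n d c2 -> (forall j, c2 (j + d) = c2 j) ->
    psum c2 0 d <= d -> psum c2 k t = t.
  move=> u2 p2 s2.
  have e : psum c2 k d = psum c2 k t + psum c2 (k + t) (d - t).
    by rewrite -psum_add; congr psum; lia.
  rewrite psum_period // in e.
  have := @ucode_ge n d c2 k t td; rewrite -u2 => /(_ ltac:(lia)).
  have := @ucode_ge n d c2 (k + t) (d - t) ltac:(lia); rewrite -u2 => /(_ ltac:(lia)).
  lia.
have := block c (frefl _) pc sc; have := block c' uE pc' sc'.
rewrite -(prednK t0) !psumSl.
suff -> : psum c k.+1 t.-1 = psum c' k.+1 t.-1 by lia.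
apply: eq_psum => i it; apply: (ucode_inj_fin dn uE).
rewrite ltnNge; apply/negP => hi.
have := tmin i.+1; rewrite -addSnnS hi => /(_ isT); lia.
Qed.

(* [par u k j]: the interval [k, k + u k] is the innermost one containing [j]. *)
Definition par (u : nat -> nat) (k j : nat) : bool :=
  [&& k < j, j <= k + u k & [forall i : 'I_j, (k < i) ==> (i + u i < j)]].

Lemma parP u k j :
  reflect [/\ k < j, j <= k + u k & forall i, k < i < j -> i + u i < j] (par u k j).
Proof.
apply: (iffP and3P) => [][kj ju h]; split=> //.
  move=> i /andP[ki ij]; have /forallP/(_ (Ordinal ij)) := h.
  by rewrite /= ki.
by apply/forallP => i; apply/implyP => ki; apply: h; rewrite ki /=.
Qed.

Lemma par_uniq u k k' j : par u k j -> par u k' j -> k = k'.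
Proof.
move=> /parP[a b h] /parP[a' b' h']; have := h k'; have := h' k; lia.
Qed.

(** Take the latest start, from [x] on, whose interval still reaches [j]. *)
Lemma par_exists u x j : x < j <= x + u x -> exists2 y, x <= y & par u y j.
Proof.
move=> /andP[xj ju].
have hex : exists y, (x <= y < j) && (j <= y + u y) by exists x; lia.
have hub : forall y, (x <= y < j) && (j <= y + u y) -> y <= j by lia.
have [y /andP[hy juy] ymax] := ex_maxnP hex hub.
exists y; first by lia.
apply/parP; split=> //; first by lia.
move=> i hi; rewrite ltnNge; apply/negP => hj; have := ymax i; lia.
Qed.

Lemma par_period d u : (forall k, u (k + d) = u k) ->
  forall k j, par u (k + d) (j + d) = par u k j.
Proof.
move=> pu k j; apply/parP/parP => [][a b h]; rewrite ?pu in b *; split; try lia.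
  by move=> i hi; have := h (i + d); rewrite pu; lia.
move=> i hi; have := h (i - d); rewrite -(pu (i - d)) subnK; lia.
Qed.

(** The interval at [k + d] is as long as the one at [k], so it also reaches [j] and hides it from
    [k]. Hence offsets up to [d] are enough in [ccode]. *)
Lemma par_far d u k j : 0 < d -> (forall k, u (k + d) = u k) -> k + d < j -> par u k j = false.
Proof.
move=> d0 pu kj; apply/negP => /parP[a b h].
have := h (k + d); rewrite pu; lia.
Qed.

Definition ccode (d : nat) (u : nat -> nat) (k : nat) : nat :=
  \sum_(t < d) par u k (k + t.+1).

Lemma sum_bool_le1 m (b : nat -> bool) :
  (forall i j, i < m -> j < m -> b i -> b j -> i = j) -> \sum_(i < m) b i <= 1.
Proof.
elim: m => [|m IH] h; first by rewrite big_ord0.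
rewrite big_ord_recr /=; case bm: (b m); last first.
  by rewrite addn0; apply: IH => i j im jm; apply: h; lia.
rewrite big1 // => i _; apply/eqP; rewrite eqb0; apply/negP => bi.
have := h i m; have := ltn_ord i => im /(_ ltac:(lia) ltac:(lia) bi bm); lia.
Qed.

Lemma ccode_period d u : (forall k, u (k + d) = u k) ->
  forall k, ccode d u (k + d) = ccode d u k.
Proof.
by move=> pu k; apply: eq_bigr => t _; rewrite addnAC par_period.
Qed.

(* Regroup the pairs (k, j) with [par u k j] by the residue of j instead of that of k. *)
Lemma ccode_total d u : (forall k, u (k + d) = u k) -> psum (ccode d u) 0 d <= d.
Proof.
move=> pu; rewrite /psum /ccode exchange_big /=.
(* For a fixed offset [t.+1], the period is shifted by [d - t.+1], so that the target becomes
   [k + d]. *)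
have -> : \sum_(t < d) \sum_(k < d) par u (0 + k) (0 + k + t.+1) =
          \sum_(t < d) \sum_(k < d) par u (k + (d - t.+1)) (k + d).
  apply: eq_bigr => t _.
  have := @psum_period d (fun k => par u k (k + t.+1)).
  rewrite {1}/psum => /(_ _ (d - t.+1)) h.
  rewrite -[LHS]h; last by move=> k; rewrite addnAC par_period.
  apply: eq_bigr => k _; congr (nat_of_bool (par u _ _)); have := ltn_ord t; lia.
rewrite exchange_big /=.
apply: (@leq_trans (\sum_(k < d) 1)); last by rewrite sum1_card card_ord.
apply: leq_sum => k _.
apply: (@sum_bool_le1 d (fun t => par u (k + (d - t.+1)) (k + d))) => i j id jd hi hj.
by have := par_uniq hi hj; lia.
Qed.

Lemma psum_eq0 c k t : (forall i, i < t -> c (k + i) = 0) -> psum c k t = 0.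
Proof. by move=> h; apply: big1 => i _; apply: h. Qed.

(** Indexing by the target [k + j.+1] gives all sources [k + i] one common range, so that sums over
    sources and targets can be exchanged. The added targets contribute zero. *)
Lemma ccodeE d u k i M : 0 < d -> (forall k, u (k + d) = u k) -> i + d <= M ->
  ccode d u (k + i) = \sum_(j < M) par u (k + i) (k + j.+1).
Proof.
move=> d0 pu iM.
pose g j : nat := par u (k + i) (k + j.+1).
rewrite -[RHS]/(psum g 0 M) (_ : M = i + (d + (M - i - d))); last by lia.
rewrite !psum_add [psum g 0 i]psum_eq0 ?[psum g (_ + d) _]psum_eq0.
- by rewrite add0n addn0; apply: eq_bigr => t _; rewrite /g -addnS addnA.
- by move=> j hj; rewrite /g (@par_far d) //; lia.
- by move=> j hj; rewrite /g; apply/eqP; rewrite eqb0; apply/negP => /parP[]; lia.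
Qed.

Lemma psum_ccode d u k s M : 0 < d -> (forall k, u (k + d) = u k) -> s + d <= M ->
  psum (ccode d u) k s = \sum_(j < M) \sum_(i < s) par u (k + i) (k + j.+1).
Proof.
move=> d0 pu sM; rewrite exchange_big /=; apply: eq_bigr => i _.
by apply: ccodeE => //; have := ltn_ord i; lia.
Qed.

(** Each of the [s] positions after [k] lies in the interval of [k], so its innermost interval
    starts between [k] and itself, hence at one of the [s] sources. *)
Lemma psum_ccode_ge d u k s : 0 < d -> (forall k, u (k + d) = u k) ->
  s <= u k -> s <= psum (ccode d u) k s.
Proof.
move=> d0 pu su; rewrite (psum_ccode k d0 pu (leqnn _)).
rewrite big_split_ord /=; apply: leq_trans (leq_addr _ _).
apply: (@leq_trans (\sum_(j < s) 1)); first by rewrite sum1_card card_ord.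
apply: leq_sum => j _.
have [|y ky py] := @par_exists u k (k + j.+1); first by have := ltn_ord j; lia.
have ys : y - k < s by have /parP[] := py; have := ltn_ord j; lia.
rewrite (bigD1 (Ordinal ys)) //= subnKC // py; lia.
Qed.

(** By nestedness the intervals starting in the block of [k] end within it, so they have at most
    [u k] targets, and each target is counted at most once. *)
Lemma psum_ccode_le n d u k : 0 < d -> (forall k, u (k + d) = u k) -> nested n u ->
  u k < n -> psum (ccode d u) k (u k).+1 <= u k.
Proof.
move=> d0 pu vu un.
rewrite (@psum_ccode d u k _ (u k + d.+1)) //; last by lia.
rewrite big_split_ord /= [X in _ + X]big1 => [|j _].
  rewrite addn0; apply: (@leq_trans (\sum_(j < u k) 1)).
    apply: leq_sum => j _.
    apply: (@sum_bool_le1 _ (fun i => par u (k + i) (k + j.+1))) => a b _ _ ha hb.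
    by have := par_uniq ha hb; lia.
  by rewrite sum1_card card_ord.
apply: big1 => i _; apply/eqP; rewrite eqb0; apply/negP => /parP[a b _].
have := ltn_ord i; have := vu k i un.
case: (posnP i) => [i0|]; last by lia.
by move: b; rewrite i0 addn0; lia.
Qed.

(** By [psum_ccode_ge] the path of [ccode d u] stays nonnegative for [u k] steps, so the code cannot
    be smaller; if [u k < n], [psum_ccode_le] makes it stop there. *)
Lemma ccodeK n d u : 0 < d -> d <= n -> (forall k, u (k + d) = u k) -> nested n u ->
  (forall k, u k <= n) -> ucode n d (ccode d u) =1 u.
Proof.
move=> d0 dn pu vu un k; set c := ccode d u.
have [ukn|ukn] := ltnP (u k) n.
  have ud : u k < d.
    (* A finite block of length at least [d] would contain its own translate by [d], against
       nestedness. *)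
    by rewrite ltnNge; apply/negP => du; have := vu k d ukn; rewrite pu; lia.
  have le := ucode_min n ud (psum_ccode_le d0 pu vu ukn).
  apply/eqP; rewrite eqn_leq le /= leqNgt; apply/negP => lt.
  have := @ucode_eq n d c k dn ltac:(lia).
  have := @psum_ccode_ge d u k (ucode n d c k).+1 d0 pu ltac:(lia).
  rewrite -/c; lia.
apply/eqP; rewrite eqn_leq [u k <= _](leq_trans (un k)) ?andbT.
  by apply: leq_trans ukn; apply: ucode_le.
rewrite leqNgt; apply/negP => lt.
have ud := ucode_fin lt.
have := @ucode_eq n d c k dn ud.
have := @psum_ccode_ge d u k (ucode n d c k).+1 d0 pu ltac:(lia).
rewrite -/c; lia.
Qed.

(** * 312-avoiding windows and their codes *)

Lemma count_lt_mono (s : seq nat) x y : x \in s ->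
  (count (fun z => z < x) s < count (fun z => z < y) s) = (x < y).
Proof.
move=> xs; apply/idP/idP => [|xy].
  apply: contraTT; rewrite -!leqNgt => yx; apply: sub_count => z /=; lia.
elim: s xs => [//|a s IH]; rewrite inE => /orP[/eqP <-|xs] /=.
  rewrite ltnn xy add0n add1n ltnS; apply: sub_count => z /=; lia.
have := IH xs; case: (ltnP a x); case: (ltnP a y); lia.
Qed.

(** The count of smaller entries reflects the order, by [count_lt_mono], and depends on the order
    alone. *)
Lemma std_eqP (s t : seq nat) : size s = size t ->
  reflect (forall i j, i < size s -> j < size s ->
             (nth 0 s i < nth 0 s j) = (nth 0 t i < nth 0 t j))
          (std s == std t).
Proof.
move=> st; apply: (iffP eqP) => [e i j ic jc|h].
  have nthE k : k < size s -> count (fun z => z < nth 0 s k) s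
                            = count (fun z => z < nth 0 t k) t.
    move=> ks; have := congr1 (fun x => nth 0 x k) e.
    by rewrite !(nth_map 0) // -st.
  by rewrite -(@count_lt_mono s) ?mem_nth // !nthE // count_lt_mono // mem_nth -?st.
apply: (@eq_from_nth _ 0); rewrite !size_map // => i is_.
rewrite !(nth_map 0) -?st // -!sum1_count [LHS](big_nth 0) [RHS](big_nth 0) !big_mkord -st.
by apply: eq_bigl => j; apply: h.
Qed.

Section PermWords.
Variable n : nat.
Implicit Type s t : {perm 'I_n.+1}.

(* Positions are counted from the right end of the word. *)
Definition rval s (a : nat) : nat := s (inord (n - a)).

Lemma nth_word s i : i <= n -> nth 0 (word s) i = s (inord i).
Proof.
move=> i_n; rewrite /word (nth_map ord0) ?size_enum_ord //.
by congr (nat_of_ord (s _)); apply: val_inj; rewrite /= nth_enum_ord // inordK.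
Qed.

Lemma size_word s : size (word s) = n.+1.
Proof. by rewrite size_map size_enum_ord. Qed.

Lemma rval_ord s (i : 'I_n.+1) : rval s (n - i) = s i.
Proof.
congr (nat_of_ord (s _)); apply: val_inj; rewrite /= inordK; have := ltn_ord i; lia.
Qed.

(** Counted from the right, a 312 pattern is [a < b < c] with the values at [b], [a], [c]
    increasing. Since values are distinct, its absence becomes an implication. *)
Lemma avoids312P s :
  reflect (forall a b c, a < b -> b < c -> c <= n -> rval s a < rval s c -> rval s a < rval s b)
          (avoids312 s).
Proof.
apply: (iffP idP) => [/existsPn h a b c ab bc cn ac|h].
  have /existsPn/(_ (inord (n - b)))/existsPn/(_ (inord (n - a))) := h (inord (n - c)).
  rewrite -/(rval s a) -/(rval s b) -/(rval s c) !inordK ?ac ?andbT; try lia.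
  have : rval s a <> rval s b.
    move/val_inj/perm_inj/(congr1 val); rewrite /= !inordK; lia.
  lia.
apply/existsPn => i; apply/existsPn => j; apply/existsPn => k; apply/negP => /and4P[ij jk sjk ski].
have := h (n - k) (n - j) (n - i); rewrite !rval_ord.
have := ltn_ord k; lia.
Qed.

(** The head loses its leftmost letter, which keeps positions from the right; the tail loses its
    rightmost letter, which shifts them by one. *)
Lemma overlapP s t :
  reflect (forall a b, a < n -> b < n ->
             (rval s a < rval s b) = (rval t a.+1 < rval t b.+1))
          (ehead s == etail t).
Proof.
have sz : size (drop 1 (word s)) = size (take n (word t)).
  by rewrite size_drop size_take !size_word ltnSn subn1.
have szn : size (drop 1 (word s)) = n by rewrite size_drop size_word subn1.
apply: (iffP (std_eqP sz)); rewrite szn => h i j i_n j_n.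
  have := h (n - i.+1) (n - j.+1); rewrite !nth_drop !nth_take; try lia.
  rewrite !nth_word /rval; try lia.
  have e k : k < n -> 1 + (n - k.+1) = n - k by lia.
  by rewrite !e //; apply; lia.
have := h (n - i.+1) (n - j.+1); rewrite !nth_drop !nth_take ?nth_word; try lia.
rewrite /rval.
have e k : k < n -> n - (n - k.+1) = 1 + k by lia.
have e' k : k < n -> n - (n - k.+1).+1 = k by lia.
by rewrite !e // !e' //; apply; lia.
Qed.

Lemma card_ord_lt m : m <= n.+1 -> #|[set y : 'I_n.+1 | y < m]| = m.
Proof.
move=> mn; have wi : injective (widen_ord mn) by move=> x y /(congr1 val) /= /val_inj.
rewrite -[RHS]card_ord -(card_imset _ wi).
apply: eq_card => y; rewrite inE; apply/idP/imsetP => [ym|[x _ ->]].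
  by exists (Ordinal ym) => //; apply: val_inj.
exact: (ltn_ord x).
Qed.

Lemma card_ord_itv i : i <= n -> #|[set y : 'I_n.+1 | i <= y < n]| = n - i.
Proof.
move=> i_n; have := cardsUI [set y : 'I_n.+1 | y < i] [set y : 'I_n.+1 | i <= y < n].
rewrite (_ : _ :|: _ = [set y : 'I_n.+1 | y < n]); last by apply/setP => y; rewrite !inE; lia.
rewrite (_ : _ :&: _ = set0); last by apply/setP => y; rewrite !inE; lia.
by rewrite cards0 !card_ord_lt; lia.
Qed.

Lemma perm_rank s x : #|[set y | s y < s x]| = s x.
Proof.
rewrite -[RHS](@card_ord_lt (s x)); last exact: ltnW (ltn_ord _).
rewrite -(card_imset _ (@perm_inj _ s)); apply: eq_card => y; rewrite inE.
apply/imsetP/idP => [[z + ->]|h]; first by rewrite inE.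
by exists (s^-1%g y); rewrite ?inE permKV.
Qed.

Lemma rval_inj s t :
  (forall a b, a <= n -> b <= n -> (rval s a < rval s b) = (rval t a < rval t b)) -> s = t.
Proof.
move=> h; apply/permP => x; apply: val_inj => /=.
rewrite -perm_rank -[RHS]perm_rank; apply: eq_card => y; rewrite !inE -!rval_ord.
apply: h; lia.
Qed.

(* In a 312-avoider the entries exceeding the last one form the block just before it. *)
Lemma avoids312_last s : avoids312 s -> forall b, 0 < b <= n ->
  (rval s 0 < rval s b) = (b <= n - rval s 0).
Proof.
move=> /avoids312P av b /andP[b0 bn].
have big : #|[set y | rval s 0 < s y]| = n - rval s 0.
  have := cardsC [set y | s y < s (inord n)]; rewrite perm_rank card_ord.
  rewrite (cardsD1 (inord n)) !inE ltnn /=.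
  suff -> : (~: [set y | s y < s (inord n)]) :\ inord n = [set y | rval s 0 < s y].
    by rewrite /rval subn0 add1n addnS => -[e]; rewrite -[X in X - _]e addKn.
  apply/setP => y; rewrite !inE -leqNgt /rval subn0 ltn_neqAle andbC [RHS]andbC; congr (_ && _).
  by rewrite eq_sym (inj_eq val_inj) (inj_eq perm_inj).
(* If [b] exceeds the last entry, avoidance makes positions [1] to [b] all exceed it, so there are
   at least [b] such entries. *)
rewrite -big; apply/idP/idP => [h|].
  rewrite -[b](subKn bn) -card_ord_itv ?leq_subr //; apply: subset_leq_card; apply/subsetP => y; rewrite !inE -(rval_ord s y) => hy.
  have [->//|ne] := eqVneq (n - y) b.
  by apply: (av 0 (n - y) b); lia.
(* If [b] does not exceed it, neither does any position beyond [b], so at most [b - 1] entries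
   do. *)
apply: contraTT; rewrite -!leqNgt => h.
suff : #|[set y | rval s 0 < s y]| <= n - (n - b).+1 by lia.
rewrite -card_ord_itv; last by lia.
apply: subset_leq_card; apply/subsetP => y; rewrite !inE -(rval_ord s y) => hy.
have yn : y < n.
  have := ltn_ord y; rewrite ltnS leq_eqVlt => /orP[/eqP e|//].
  by move: hy; rewrite e subnn ltnn.
rewrite yn andbT ltnNge; apply/negP => yb.
have [e|ne] := eqVneq (n - y) b; first by move: hy; rewrite e; lia.
have := av 0 b (n - y); lia.
Qed.

Lemma perm_of_order (R : rel 'I_n.+1) :
  irreflexive R -> transitive R -> (forall x y, x != y -> R x y || R y x) ->
  exists s, forall x y, (s x < s y) = R x y.
Proof.
move=> irr tr tot.
pose rk x := #|[set y | R y x]|.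
have rkn x : rk x < n.+1.
  rewrite -[X in _ < X]card_ord -cardsT; apply: proper_card.
  by rewrite properT; apply/eqP => /setP/(_ x); rewrite !inE irr.
have rkR x y : R x y -> rk x < rk y.
  move=> xy; apply: proper_card; apply/properP; split.
    by apply/subsetP => z; rewrite !inE => /tr; apply.
  by exists x; rewrite !inE ?irr.
have rkE x y : (rk x < rk y) = R x y.
  apply/idP/idP => [lt|]; last exact: rkR.
  have [e|/tot/orP[//|/rkR]] := eqVneq x y; first by rewrite e ltnn in lt.
  by rewrite ltnNge ltnW.
have inj : injective (fun x => Ordinal (rkn x)).
  move=> x y /(congr1 val) /= e; apply/eqP; apply/negP => /negP/tot.
  by rewrite -!rkE e ltnn.
by exists (perm inj) => x y; rewrite !permE /=.
Qed.
End PermWords.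

(* The order that the code [u] prescribes between the positions [k + a] and
   [k + b] of the reversed walk: [k] is below exactly the [u k] positions after it. *)
Definition worder (u : nat -> nat) (k a b : nat) : bool :=
  if a < b then b - a <= u (k + a) else (b < a) && (u (k + b) < a - b).

(** A block of length at least [n] reaches every later position of the window; shorter ones are
    compared by nestedness, restated as [h]. *)
Lemma worder_trans n u k a b c : nested n u -> a <= n -> b <= n -> c <= n ->
  worder u k a b -> worder u k b c -> worder u k a c.
Proof.
move=> vu an bn cn; rewrite /worder.
have h x y : x < y -> u (k + x) < n -> y - x <= u (k + x) -> y - x + u (k + y) <= u (k + x).
  move=> xy un yx; have := vu (k + x) (y - x) un; rewrite -addnA subnKC; lia.
case: (ltngtP a b) => ab; case: (ltngtP b c) => bc; case: (ltngtP a c) => ac //=;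
  rewrite ?ab ?bc ?ac //; try (subst; lia).
- have := h a b; lia.
- have := h c a; lia.
- have := h b c; lia.
Qed.

(** For nested [u] the relation [worder u k] is a strict total order on the window, so the default
    [1%g] is not reached; see [rval_wperm]. *)
Definition wperm (n : nat) (u : nat -> nat) (k : nat) : {perm 'I_n.+1} :=
  odflt 1%g [pick s : {perm 'I_n.+1} | [forall x : 'I_n.+1, forall y : 'I_n.+1,
    (s x < s y) == worder u k (n - x) (n - y)]].

Lemma rval_wperm n u k a b : nested n u -> a <= n -> b <= n ->
  (rval (wperm n u k) a < rval (wperm n u k) b) = worder u k a b.
Proof.
move=> vu an bn; rewrite /wperm; case: pickP => [s /= hs|].
  have /forallP/(_ (inord (n - a)))/forallP/(_ (inord (n - b)))/eqP -> := hs.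
  by rewrite !inordK ?subKn //; lia.
have [||x y|s hs] := @perm_of_order n (fun x y => worder u k (n - x) (n - y)).
- by move=> x; rewrite /worder ltnn.
- by move=> x y z; apply: worder_trans vu _ _ _; lia.
- move=> xy; have {}xy : x <> y :> nat by move/val_inj/eqP; apply/negP.
  by rewrite /worder; case: ltngtP => /=; have := ltn_ord x; have := ltn_ord y; lia.
move/(_ s)/negP; case; apply/forallP => x; apply/forallP => y; apply/eqP; exact: hs.
Qed.

Lemma eq_wperm n u k u' k' : (forall i, u (k + i) = u' (k' + i)) ->
  wperm n u k = wperm n u' k'.
Proof.
move=> h; congr (odflt _ _); apply: eq_pick => s /=.
by apply: eq_forallb => x; apply: eq_forallb => y; rewrite /worder !h.
Qed.

Lemma avoids312_wperm n u k : nested n u -> avoids312 (wperm n u k).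
Proof.
move=> vu; apply/avoids312P => a b c ab bc cn; rewrite !rval_wperm //; try lia.
rewrite /worder ab (ltn_trans ab bc); lia.
Qed.

Lemma overlap_wperm n u k : nested n u ->
  ehead (wperm n u k.+1) == etail (wperm n u k).
Proof.
move=> vu; apply/overlapP => a b an bn; rewrite !rval_wperm //; try lia.
by rewrite /worder !ltnS !subSS !addSnnS.
Qed.

Lemma code_wperm n u k : nested n u -> (forall k, u k <= n) ->
  n - rval (wperm n u k) 0 = u k.
Proof.
move=> vu un; set s := wperm _ _ _.
have h b : 0 < b <= n -> (b <= u k) = (b <= n - rval s 0).
  move=> bn; rewrite -avoids312_last ?avoids312_wperm // rval_wperm //; last by lia.
  by rewrite /worder addn0 subn0 (_ : 0 < b); lia.
have := h (u k); have := h (n - rval s 0); have := un k; lia.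
Qed.

(** Each overlap passes to the next window and brings both positions one closer to the right end.
    After [a] of them the first is the last letter, where [avoids312_last] decides. *)
Lemma walk_order n (E : nat -> {perm 'I_n.+1}) :
  (forall k, avoids312 (E k)) -> (forall k, ehead (E k.+1) == etail (E k)) ->
  forall k a b, a < b <= n ->
  (rval (E k) a < rval (E k) b) = (b - a <= n - rval (E (k + a)) 0).
Proof.
move=> av ov k a; elim: a k => [|a IH] k b /andP[ab bn].
  by rewrite subn0 addn0 avoids312_last // ab.
case: b ab bn => [//|b] ab bn.
by have /overlapP <- := ov k; try lia; rewrite IH ?subSS ?addSnnS; lia.
Qed.

(** If the block of [k + t] stuck out, the entry at offset [(u k).+1] of window [k] would exceed the
    one at [t], hence the one at [0], although it lies just outside the block of [k]. It is in the
    window because [u k < n]. *)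
Lemma walk_nested n (E : nat -> {perm 'I_n.+1}) :
  (forall k, avoids312 (E k)) -> (forall k, ehead (E k.+1) == etail (E k)) ->
  nested n (fun k => n - rval (E k) 0).
Proof.
move=> av ov k t; set u := fun k => n - rval (E k) 0.
rewrite -/(u k) -/(u (k + t)) => un /andP[t0 tu].
rewrite leqNgt; apply/negP => lt.
have W := walk_order av ov.
have := W k t (u k).+1; rewrite -/(u (k + t)) => h1.
have := W k 0 t; rewrite addn0 -/(u k) => h2.
have := W k 0 (u k).+1; rewrite addn0 -/(u k) => h3.
move: (h1 ltac:(lia)) (h2 ltac:(lia)) (h3 ltac:(lia)); lia.
Qed.

Lemma walk_wperm n (E : nat -> {perm 'I_n.+1}) :
  (forall k, avoids312 (E k)) -> (forall k, ehead (E k.+1) == etail (E k)) ->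
  forall k, wperm n (fun k => n - rval (E k) 0) k = E k.
Proof.
move=> av ov k; have vu := walk_nested av ov; apply: rval_inj => a b an bn.
rewrite rval_wperm // /worder.
have W x y : x < y <= n -> _ := @walk_order n E av ov k x y.
case: ltngtP => [ab|ba|->]; last by rewrite ltnn.
  by rewrite W // ab.
have := W b a; have : rval (E k) a <> rval (E k) b.
  move/val_inj/perm_inj/(congr1 val); rewrite /= !inordK; lia.
rewrite /=; lia.
Qed.

(** * Periods of closed walks *)

Definition pext (T : Type) (x0 : T) (s : seq T) (k : nat) : T := nth x0 s (k %% size s).

Lemma pextD (T : Type) (x0 : T) s k : pext x0 s (k + size s) = pext x0 s k.
Proof. by rewrite /pext modnDr. Qed.

Lemma pext_small (T : Type) (x0 : T) s k : k < size s -> pext x0 s k = nth x0 s k.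
Proof. by move=> h; rewrite /pext modn_small. Qed.

Lemma pext_inj (T : Type) (x0 : T) s t : size s = size t ->
  pext x0 s =1 pext x0 t -> s = t.
Proof.
move=> st h; apply: (eq_from_nth st) => i si.
by rewrite -!pext_small -?st.
Qed.

Lemma pext_rot (T : Type) (x0 : T) s i k : 0 < size s -> i <= size s ->
  pext x0 (rot i s) k = pext x0 s (k + i).
Proof.
move=> s0 is_; rewrite /pext size_rot -(modnDml k).
have := ltn_pmod k s0; move: (k %% size s) => r rs.
rewrite /rot nth_cat size_drop; case: ltnP => h.
  by rewrite nth_drop modn_small 1?addnC //; lia.
rewrite nth_take; last by lia.
rewrite (_ : r + i = r - (size s - i) + size s) ?modnDr ?modn_small //; lia.
Qed.

(** The index is [- (k + 1)] modulo the length, with [(size s).-1] standing for [- 1]. *)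
Lemma pext_rev (T : Type) (x0 : T) s k : 0 < size s ->
  pext x0 (rev s) k = pext x0 s (k.+1 * (size s).-1).
Proof.
move=> s0; rewrite /pext size_rev nth_rev ?ltn_pmod //; congr nth.
have := ltn_pmod k s0; have := divn_eq k (size s).
move: (k %% size s) (k %/ size s) => r q -> rs.
rewrite (_ : (q * size s + r).+1 * (size s).-1 =
   (q * (size s).-1 + r) * size s + (size s - r.+1)); last by nia.
by rewrite modnMDl modn_small //; lia.
Qed.

Lemma periodic_addM (T : Type) (f : nat -> T) d : (forall k, f (k + d) = f k) ->
  forall q k, f (k + q * d) = f k.
Proof.
by move=> pf; elim=> [|q IH] k; rewrite ?addn0 // mulSn addnA IH pf.
Qed.

Lemma periodic_mod (T : Type) (f : nat -> T) d : (forall k, f (k + d) = f k) ->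
  forall k, f (k %% d) = f k.
Proof.
by move=> pf k; rewrite [in RHS](divn_eq k d) addnC (periodic_addM pf).
Qed.

Lemma pext_mktuple (T : Type) (x0 : T) (f : nat -> T) d : 0 < d ->
  (forall k, f (k + d) = f k) -> pext x0 [tuple f i | i < d] =1 f.
Proof.
move=> d0 pf k; rewrite /pext size_tuple.
rewrite -(tnth_nth x0 _ (Ordinal (ltn_pmod k d0))) tnth_mktuple /=.
exact: periodic_mod.
Qed.

Lemma min_period (T : eqType) (f : nat -> T) d : 0 < d -> (forall k, f (k + d) = f k) ->
  exists2 e, 0 < e & forall i j, (forall k, f (k + i) = f (k + j)) <-> i = j %[mod e].
Proof.
move=> d0 pf.
pose b e := (0 < e) && [forall k : 'I_d, f (k + e) == f k].
have bP e : b e -> forall k, f (k + e) = f k.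
  move=> /andP[_ /forallP h] k.
  have /eqP := h (Ordinal (ltn_pmod k d0)); rewrite /= (periodic_mod pf) => <-.
  have pg m : f (m + d + e) = f (m + e) by rewrite addnAC pf.
  by rewrite (periodic_mod (f := fun m => f (m + e)) pg).
have bd : exists e, b e by exists d; rewrite /b d0; apply/forallP => k; rewrite pf.
have [e be emin] := ex_minnP bd.
have e0 : 0 < e by case/andP: be.
exists e => // i j.
have pe := bP e be.
split=> [|ij k]; last first.
  have pg m : f (k + (m + e)) = f (k + m) by rewrite addnA pe.
  rewrite -(periodic_mod (f := fun m => f (k + m)) pg).
  by rewrite -[RHS](periodic_mod (f := fun m => f (k + m)) pg) ij.
wlog le : i j / i <= j => [W h|h].
  by case: (leqP i j) => [/W|/ltnW/W W']; [apply|symmetry; apply: W'].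
(* Moving the origin by [i * d - i] turns the shift by [i] into a multiple of [d], which
   disappears. *)
have hp m : f (m + (j - i)) = f m.
  have := h (m + (i * d - i)).
  have <- : m + i * d = m + (i * d - i) + i by nia.
  have <- : m + (j - i) + i * d = m + (i * d - i) + j by nia.
  by rewrite !(periodic_addM pf).
(* A nonzero remainder of [j - i] modulo [e] would be a period smaller than [e]. *)
apply/eqP; rewrite eq_sym eqn_mod_dvd // /dvdn; apply/negPn/negP => r0.
suff : b ((j - i) %% e) by move/emin; rewrite leqNgt ltn_pmod.
rewrite /b lt0n r0; apply/forallP => k; apply/eqP.
have pg m : f (k + (m + e)) = f (k + m) by rewrite addnA pe.
by rewrite (periodic_mod (f := fun m => f (k + m)) pg).
Qed.

Lemma sum_divisors_ord (V : nmodType) (N m : nat) (F : nat -> V) : (0 < m < N)%N ->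
  (\sum_(e < N | (e %| m)%N) F e = \sum_(e <- divisors m) F e)%R.
Proof.
move=> /andP[m0 mN]; rewrite -(big_mkord (fun e => e %| m)%N) -big_filter.
apply: perm_big; apply: uniq_perm; rewrite ?filter_uniq ?divisors_uniq ?iota_uniq // => e.
rewrite mem_filter mem_index_iota -dvdn_divisors //=.
by case em: (e %| m)%N => //=; have := dvdn_leq m0 em; lia.
Qed.

(** * Closed walks and their cyclic shifts *)

Section Walks.
Variable n : nat.
Notation edge := {perm 'I_n.+1}.
Notation ext := (pext (1%g : edge)).

Lemma ext_tuple_period d (w : d.-tuple edge) k : ext w (k + d) = ext w k.
Proof. by have := pextD 1%g w k; rewrite size_tuple. Qed.

Lemma rot_tuple_eq d (w : d.-tuple edge) i j : 0 < d -> i <= d -> j <= d ->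
  [tuple of rot i w] = [tuple of rot j w] <-> forall k, ext w (k + i) = ext w (k + j).
Proof.
move=> d0 id jd; split=> [/(congr1 (fun t : d.-tuple edge => ext t)) /= h k|h].
  by rewrite -!pext_rot ?size_tuple // h.
apply: val_inj; apply: (@pext_inj _ 1%g); rewrite ?size_rot // => k.
by rewrite !pext_rot ?size_tuple.
Qed.

(** The rotations by less than the minimal period are pairwise distinct and exhaust the class. *)
Lemma walk_class_period d (w : d.-tuple edge) : 0 < d ->
  forall i j, (forall k, ext w (k + i) = ext w (k + j)) <-> i = j %[mod #|walk_class w|].
Proof.
move=> d0.
have [e e0 he] := min_period d0 (ext_tuple_period w).
suff -> : #|walk_class w| = e by [].
have ed : e <= d.
  have /he : forall k, ext w (k + d) = ext w (k + 0) by move=> k; rewrite ext_tuple_period addn0.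
  by move/eqP; rewrite mod0n; apply: dvdn_leq.
pose g (i : 'I_e) : d.-tuple edge := [tuple of rot i w].
have gi : injective g.
  move=> i j /rot_tuple_eq h; apply: val_inj => /=.
  have /he : forall k, ext w (k + i) = ext w (k + j).
    by apply: h => //; apply: ltnW; apply: leq_trans (ltn_ord _) ed.
  by rewrite !modn_small.
suff -> : walk_class w = [set g i | i : 'I_e] by rewrite card_imset // card_ord.
apply/setP => t; apply/imsetP/imsetP => [] [i _ ->].
  exists (Ordinal (ltn_pmod i e0)) => //; apply/rot_tuple_eq => //=.
  - exact: ltnW.
  - by apply: leq_trans (leq_mod _ _) _; apply: ltnW.
  - by apply/he; rewrite modn_mod.
by exists (widen_ord ed i).
Qed.

Lemma walk_class_dvd d (w : d.-tuple edge) : 0 < d -> #|walk_class w| %| d.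
Proof.
move=> d0; have /(walk_class_period w d0) : forall k, ext w (k + d) = ext w (k + 0).
  by move=> k; rewrite ext_tuple_period addn0.
by move/eqP; rewrite mod0n.
Qed.

Lemma eq_walk_class_card d e (w : d.-tuple edge) (v : e.-tuple edge) : 0 < d -> 0 < e ->
  ext w =1 ext v -> #|walk_class w| = #|walk_class v|.
Proof.
move=> d0 e0 wv.
have dvd a b (x : a.-tuple edge) (y : b.-tuple edge) : 0 < a -> 0 < b ->
    ext x =1 ext y -> #|walk_class x| %| #|walk_class y|.
  move=> a0 b0 xy.
  have /(walk_class_period y b0) h : #|walk_class y| = 0 %[mod #|walk_class y|].
    by rewrite modnn mod0n.
  suff /eqP : #|walk_class y| = 0 %[mod #|walk_class x|] by rewrite mod0n.
  by apply/(walk_class_period x a0) => k; rewrite !xy.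
by apply/eqP; rewrite eqn_dvd !dvd // => k; rewrite wv.
Qed.

Lemma closed_walkP d (w : d.-tuple edge) : 0 < d ->
  reflect ((forall k, avoids312 (ext w k)) /\ (forall k, ehead (ext w k) == etail (ext w k.+1)))
          (closed_walk w).
Proof.
move=> d0; apply: (iffP andP) => [[/allP av /forallP ov]|[av ov]]; split.
- by move=> k; apply: av; rewrite /pext mem_nth // ltn_pmod // size_tuple.
- move=> k; have := ov (Ordinal (ltn_pmod k d0)).
  rewrite (tnth_nth 1%g) /= /pext size_tuple.
  by rewrite -(addn1 (k %% d)) modnDml addn1.
- apply/allP => s /(nthP 1%g) [i iw <-]; rewrite -pext_small //.
- apply/forallP => i; rewrite (tnth_nth 1%g); have := ov i.
  by rewrite /pext size_tuple (modn_small (ltn_ord i)).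
Qed.

Definition primitive_walks d : {set d.-tuple edge} :=
  [set w : d.-tuple edge | closed_walk w && (#|walk_class w| == d)].

(** Repeating a walk of length [e] is a bijection; its inverse keeps the first [e] edges. *)
Lemma card_period_walks d e : 0 < d -> e %| d ->
  #|[set w : d.-tuple edge | closed_walk w && (#|walk_class w| == e)]| = #|primitive_walks e|.
Proof.
move=> d0 ed; have e0 := dvdn_gt0 d0 ed.
pose f (v : e.-tuple edge) : d.-tuple edge := [tuple ext v i | i < d].
have fE v : ext (f v) =1 ext v.
  apply: (@pext_mktuple _ 1%g (ext v)) => // k.
  by rewrite -(divnK ed) (periodic_addM (ext_tuple_period v)).
have fi : injective f.
  move=> v v' h; apply: val_inj; apply: (@pext_inj _ 1%g); first by rewrite !size_tuple.
  by move=> k; rewrite -!fE h.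
rewrite -(card_imset _ fi); apply: eq_card => w; rewrite inE.
have closedE v : closed_walk (f v) = closed_walk v.
  by apply/closed_walkP/closed_walkP => // -[av ov]; split=> k; have := av k; have := ov k;
     rewrite !fE.
apply/andP/imsetP => [[cw /eqP cl]|[v]]; last first.
  by rewrite inE => /andP[cv clv] ->; rewrite closedE (eq_walk_class_card _ _ (fE v)).
pose v : e.-tuple edge := [tuple ext w i | i < e].
have vE : ext v =1 ext w.
  apply: (@pext_mktuple _ 1%g (ext w)) => // k.
  have : e = 0 %[mod #|walk_class w|] by rewrite cl modnn mod0n.
  by move/(walk_class_period w d0) => ->; rewrite addn0.
have wf : w = f v.
  apply: val_inj; apply: (@pext_inj _ 1%g); first by rewrite !size_tuple.
  by move=> k; rewrite fE vE.
exists v => //; rewrite inE -closedE -wf cw /=.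
by rewrite -(eq_walk_class_card d0 e0 (fun k => esym (vE k))) cl.
Qed.

Lemma card_closed_walks_primitive d : 0 < d ->
  #|[set w : d.-tuple edge | closed_walk w]| = \sum_(e <- divisors d) #|primitive_walks e|.
Proof.
move=> d0; rewrite -(@sum_divisors_ord nat d.+1) ?d0 //=.
rewrite -sum1_card (partition_big (fun w => inord #|walk_class w| : 'I_d.+1) (fun e : 'I_d.+1 => e %| d)).
  apply: eq_bigr => e ed; rewrite -(card_period_walks d0 ed) -sum1_card.
  apply: eq_bigl => w; rewrite !inE; congr (_ && _).
  rewrite -val_eqE /= inordK // ltnS; exact: dvdn_leq (walk_class_dvd w d0).
move=> w _; rewrite inordK ?walk_class_dvd // ltnS; exact: dvdn_leq (walk_class_dvd w d0).
Qed.

Lemma mem_walk_class d (w t : d.-tuple edge) : 0 < d -> t \in walk_class w ->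
  walk_class t = walk_class w.
Proof.
move=> d0; suff sub (x y : d.-tuple edge) : x \in walk_class y -> walk_class x \subset walk_class y
    /\ y \in walk_class x.
  move=> /sub[tw /sub[wt _]]; by apply/eqP; rewrite eqEsubset tw.
move=> /imsetP[i _ ->].
have mem k : [tuple of rot (k %% d) y] \in walk_class y.
  by apply/imsetP; exists (Ordinal (ltn_pmod k d0)).
have rotE (a : nat) j : ext (rot (a %% d) y) j = ext y (j + a).
  rewrite pext_rot ?size_tuple ?(ltnW (ltn_pmod _ _)) //.
  by apply: (periodic_mod (f := fun m => ext y (j + m))) => m; rewrite addnA ext_tuple_period.
split.
  apply/subsetP => z /imsetP[j _ ->].
  suff -> : [tuple of rot j [tuple of rot i y]] = [tuple of rot ((j + i) %% d) y] by apply: mem.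
  apply: val_inj; apply: (@pext_inj _ 1%g); first by rewrite /= !size_rot.
  move=> k; rewrite rotE /= pext_rot ?size_rot ?size_tuple ?(ltnW (ltn_ord j)) //.
  by rewrite pext_rot ?size_tuple ?(ltnW (ltn_ord i)) // addnA.
apply/imsetP; exists (Ordinal (ltn_pmod (d - i) d0)) => //.
apply: val_inj; apply: (@pext_inj _ 1%g); first by rewrite /= !size_rot.
move=> k; rewrite /= pext_rot ?size_rot ?size_tuple ?(ltnW (ltn_pmod _ _)) //.
rewrite pext_rot ?size_tuple ?(ltnW (ltn_ord i)) //.
pose g m := ext y (k + m + i).
have gp m : g (m + d) = g m by rewrite /g addnA addnAC ext_tuple_period.
rewrite -[RHS]/(g ((d - i) %% d)) (periodic_mod gp) /g.
by rewrite -addnA subnK ?(ltnW (ltn_ord i)) // ext_tuple_period.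
Qed.

(** The fibre of [walk_class] over a class is the class itself, which has [d] elements. *)
Lemma card_d_cycles d : 0 < d -> #|d_cycles n d| * d = #|primitive_walks d|.
Proof.
move=> d0.
have -> : d_cycles n d = [set walk_class w | w in primitive_walks d].
  by apply/setP => C; apply/imsetP/imsetP => -[w hw ->]; exists w => //; move: hw; rewrite !inE.
rewrite -[RHS]sum1_card (partition_big_imset (@walk_class n d)) /=.
rewrite -sum_nat_const; apply: eq_bigr => C /imsetP[w + ->].
rewrite inE => /andP[/(closed_walkP w d0) [av ov] /eqP cl].
rewrite sum1dep_card -[LHS]cl; apply: eq_card => t; rewrite !inE.
apply/idP/andP => [tw|[_ /eqP <-]]; last first.
  by apply/imsetP; exists (Ordinal d0) => //; apply: val_inj; rewrite /= rot0.
rewrite (mem_walk_class d0 tw) cl !eqxx andbT; split=> //.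
have /imsetP[i _ ->] := tw.
have E k : ext [tuple of rot i w] k = ext w (k + i).
  by rewrite pext_rot ?size_tuple ?(ltnW (ltn_ord i)).
by apply/closed_walkP => //; split=> k; rewrite !E ?addSn.
Qed.

End Walks.

(** * The number of closed walks *)

Lemma closed_walk_revP n d (w : d.-tuple {perm 'I_n.+1}) : 0 < d ->
  let E := pext 1%g (rev w) in
  reflect ((forall k, avoids312 (E k)) /\ (forall k, ehead (E k.+1) == etail (E k)))
          (closed_walk w).
Proof.
move=> d0 E.
have sz : size w = d by rewrite size_tuple.
have EW k : E k = pext 1%g w (k.+1 * d.-1) by rewrite /E pext_rev sz.
have WE k : pext 1%g w k = E (k.+1 * d.-1).
  by rewrite -{1}(revK w) pext_rev size_rev sz.
(* Modulo [d], the edge at reversed position [k] directly follows the one at [k.+1]. *)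
have stepE k : k.+1 * d.-1 + d = (k.+2 * d.-1).+1 by nia.
apply: (iffP (closed_walkP w d0)) => -[av ov]; split=> k.
- by rewrite EW.
- rewrite !EW; have := ov (k.+2 * d.-1); rewrite -stepE.
  by rewrite ext_tuple_period.
- by rewrite WE.
- rewrite !WE; have := ov (k.+2 * d.-1); rewrite -stepE /E.
  by rewrite -[X in _ + X]sz -(size_rev w) pextD.
Qed.

Definition code_walk n d (c : nat -> nat) : d.-tuple {perm 'I_n.+1} :=
  [tuple of rev [tuple wperm n (ucode n d c) i | i < d]].

Lemma ucode_period n d c : (forall k, c (k + d) = c k) ->
  forall k, ucode n d c (k + d) = ucode n d c k.
Proof. by move=> pc k; apply: eq_ucode => i; rewrite addnAC pc. Qed.

Lemma pext_code_walk n d c : 0 < d -> (forall k, c (k + d) = c k) ->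
  pext 1%g (rev (code_walk n d c)) =1 wperm n (ucode n d c).
Proof.
move=> d0 pc; rewrite revK; apply: pext_mktuple => // k.
by apply: eq_wperm => i; rewrite addnAC ucode_period.
Qed.

(** [card_partial_ord_partitions] counts the codes over one period: a sum of at most [d] bounds
    every entry by [d], whence ['I_d.+1]. *)
Lemma card_closed_walks n d : 0 < d -> d <= n ->
  #|[set w : d.-tuple {perm 'I_n.+1} | closed_walk w]| = 'C(2 * d, d).
Proof.
move=> d0 dn; rewrite mul2n -addnn -card_partial_ord_partitions.
pose c (t : d.-tuple 'I_d.+1) := pext 0 (map val t).
have pc t k : c t (k + d) = c t k.
  by rewrite -[X in _ + X](size_tuple t) -(size_map val t) /c pextD.
have sumE (t : d.-tuple 'I_d.+1) : \sum_(i <- t) i = psum (c t) 0 d.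
  rewrite /psum big_tuple; apply: eq_bigr => i _.
  by rewrite add0n /c pext_small ?size_map ?size_tuple // (nth_map ord0) ?size_tuple // (tnth_nth ord0).
pose f t := code_walk n d (c t).
have fi : {in [set t : d.-tuple 'I_d.+1 | \sum_(i <- t) i <= d] &, injective f}.
  move=> t t'; rewrite !inE !sumE => st st' ft.
  have ct : c t =1 c t'.
    apply: (ucode_inj d0 dn (pc t) (pc t') st st') => k.
    have vc x := @ucode_nested n d (c x) dn.
    rewrite -(code_wperm k (vc t)); last by move=> j; apply: ucode_le.
    rewrite -(code_wperm k (vc t')); last by move=> j; apply: ucode_le.
    by rewrite -(pext_code_walk n d0 (pc t)) -(pext_code_walk n d0 (pc t')) -/(f t) ft.
  apply: val_inj; apply: (inj_map val_inj).
  by apply: (@pext_inj _ 0); rewrite ?size_map ?size_tuple.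
rewrite -(card_in_imset fi); apply: eq_card => w; rewrite inE.
apply/idP/imsetP => [/closed_walk_revP|[t + ->]]; last first.
  rewrite inE sumE => st; apply/closed_walk_revP => //.
  have vc := @ucode_nested n d (c t) dn.
  by split=> k; rewrite !pext_code_walk // ?avoids312_wperm ?overlap_wperm.
move=> /(_ d0)[av ov]; set E := pext 1%g (rev w) in av ov.
pose u k := n - rval (E k) 0.
have vu : nested n u := walk_nested av ov.
have pE k : E (k + d) = E k.
  by rewrite -[X in _ + X](size_tuple w) -size_rev /E pextD.
have pu k : u (k + d) = u k by rewrite /u pE.
have un k : u k <= n by apply: leq_subr.
have pcc := ccode_period pu.
have tot := ccode_total pu.
(* This bound makes the [inord] in [t] faithful. *)
have cle k : ccode d u k <= d.
  apply: leq_trans tot; rewrite -(psum_period pcc k) -(prednK d0) psumSl; lia.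
pose t : d.-tuple 'I_d.+1 := [tuple inord (ccode d u i) | i < d].
have ct : c t =1 ccode d u.
  move=> k; rewrite -(pext_mktuple 0 d0 pcc k) /c; congr (pext 0 _ k).
  rewrite /t /= -map_comp; apply: eq_map => i /=.
  by rewrite inordK // ltnS.
have uE : ucode n d (c t) =1 u.
  move=> k; rewrite -(ccodeK d0 dn pu vu un k) /ucode.
  suff /eq_find -> : (fun s => psum (c t) k s.+1 <= s) =1 (fun s => psum (ccode d u) k s.+1 <= s).
    by [].
  by move=> s; rewrite (eq_psum (c' := ccode d u)).
exists t; first by rewrite inE sumE (eq_psum (c' := ccode d u)).
apply: val_inj; apply: (can_inj (@revK _)).
apply: (@pext_inj _ 1%g) => [|k]; first by rewrite !size_rev !size_tuple.
rewrite pext_code_walk // -/E -(walk_wperm av ov).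
by apply: eq_wperm => i; rewrite uE.
Qed.

(** * Moebius inversion *)

Local Open Scope ring_scope.

Lemma moebius_primeM_dvd (p f : nat) : prime p -> (0 < f)%N -> (p %| f)%N ->
  moebius (p * f) = 0.
Proof.
move=> pp f0 pf; rewrite /moebius ifF //; apply/negP => /allP/(_ p).
have p0 := prime_gt0 pp.
rewrite primesM // primes_prime // !inE eqxx /= => /(_ isT).
rewrite lognM // logn_prime // eqxx eqn_leq andbC /=.
by have := logn_gt0 p f; rewrite mem_primes pp f0 pf /=; lia.
Qed.

Lemma moebius_primeM_coprime (p f : nat) : prime p -> (0 < f)%N -> ~~ (p %| f)%N ->
  moebius (p * f) = - moebius f.
Proof.
move=> pp f0 pf; have p0 := prime_gt0 pp.
have perm : perm_eq (primes (p * f)) (p :: primes f).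
  apply: uniq_perm; rewrite /= ?primes_uniq ?mem_primes ?(negPf pf) ?andbF //.
  by move=> q; rewrite primesM // primes_prime // !inE.
rewrite /moebius (perm_all _ perm) (perm_size perm) /=.
rewrite lognM // logn_prime // eqxx /= lognE pp f0 (negPf pf) /=.
have -> : all (fun q => logn q (p * f) == 1)%N (primes f)
        = all (fun q => logn q f == 1)%N (primes f).
  apply: eq_in_all => q; rewrite mem_primes => /and3P[qp _ qf].
  rewrite lognM // logn_prime //; case: (eqVneq q p) qf => // -> h; by rewrite h in pf.
by case: ifP; rewrite ?oppr0 // exprS mulN1r.
Qed.

(** For a prime [p] dividing [m], the divisors [p * f] with [p] dividing [f] give zero, and those
    with [p] not dividing [f] cancel the divisors of [m] prime to [p]. *)
Lemma sum_moebius (m : nat) : (0 < m)%N ->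
  \sum_(e <- divisors m) moebius e = (m == 1)%N%:R.
Proof.
move=> m0; have [->|m1] := eqVneq m 1%N; first by rewrite big_seq1.
have pp : prime (pdiv m) by apply: pdiv_prime; lia.
set p := pdiv m in pp; have pm : (p %| m)%N by apply: pdiv_dvd.
have p0 := prime_gt0 pp.
have q0 : (0 < m %/ p)%N by rewrite divn_gt0 // dvdn_leq.
have mE : (m = p * (m %/ p))%N by rewrite mulnC divnK.
rewrite (bigID (fun e => p %| e)%N) /=.
have -> : \sum_(e <- divisors m | (p %| e)%N) moebius e
        = \sum_(f <- divisors (m %/ p)) moebius (p * f).
  rewrite -big_filter -[RHS](big_map (muln p) predT moebius).
  apply: perm_big; apply: uniq_perm.
  - by rewrite filter_uniq ?divisors_uniq.
  - by rewrite map_inj_uniq ?divisors_uniq // => x y /eqP; rewrite eqn_pmul2l // => /eqP.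
  - move=> e; rewrite mem_filter -dvdn_divisors //; apply/andP/mapP => [[pe em]|[f]].
      exists (e %/ p)%N; rewrite -?dvdn_divisors //; last by rewrite mulnC divnK.
      by rewrite dvdn_divRL // divnK.
    by rewrite -dvdn_divisors // => fm ->; rewrite dvdn_mulr // [X in (_ %| X)%N]mE dvdn_pmul2l.
rewrite (bigID (fun f => p %| f)%N) /=.
have gt0 f : f \in divisors (m %/ p) -> (0 < f)%N.
  by rewrite -dvdn_divisors // => /dvdn_gt0; apply.
rewrite big_seq_cond big1 ?add0r; last first.
  by move=> f /andP[/gt0 f0 pf]; apply: moebius_primeM_dvd.
rewrite big_seq_cond (eq_bigr (fun f => - moebius f)); last first.
  by move=> f /andP[/gt0 f0 pf]; apply: moebius_primeM_coprime.
rewrite -big_seq_cond sumrN -[X in - X]big_filter -[X in _ + X]big_filter.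
rewrite (perm_big [seq e <- divisors m | ~~ (p %| e)%N]) /= ?addNr //.
(* Among numbers prime to [p], the divisors of [m] and of [m %/ p] agree. *)
apply: uniq_perm; rewrite ?filter_uniq ?divisors_uniq // => e.
rewrite !mem_filter -!dvdn_divisors //; case pe: (p %| e)%N => //=.
by rewrite {2}mE Gauss_dvdr // coprime_sym prime_coprime ?pe.
Qed.

Lemma divn_divK (d e : nat) : (0 < d)%N -> (e %| d)%N -> (d %/ (d %/ e) = e)%N.
Proof. by move=> d0 ed; rewrite divnA // mulKn. Qed.

(** After exchanging sums, the coefficient of [P f] runs over [e] with [f] dividing [e] dividing
    [d]. The substitution [g = d / e] makes it a sum over the divisors of [d / f], evaluated by
    [sum_moebius]. *)
Lemma moebius_inversion (V : comNzRingType) (A P : nat -> V) (d : nat) : (0 < d)%N ->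
  (forall e, (e %| d)%N -> A e = \sum_(f <- divisors e) P f) ->
  \sum_(e <- divisors d) (moebius (d %/ e))%:~R * A e = P d.
Proof.
move=> d0 hA.
have dvd_gt0 e : (e %| d)%N -> (0 < e)%N by move/dvdn_gt0; apply.
have -> : \sum_(e <- divisors d) (moebius (d %/ e))%:~R * A e =
  \sum_(e < d.+1 | (e %| d)%N) \sum_(f < d.+1 | (f %| e)%N) (moebius (d %/ e))%:~R * P f.
  rewrite -(@sum_divisors_ord _ d.+1) ?d0 //=; apply: eq_bigr => e ed.
  rewrite hA // -(@sum_divisors_ord _ d.+1) ?mulr_sumr // dvd_gt0 //=; exact: ltn_ord.
rewrite (exchange_big_dep (fun f : 'I_d.+1 => f %| d)%N) /=; last first.
  by move=> e f ed fe; apply: dvdn_trans fe ed.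
have inner (f : 'I_d.+1) : (f %| d)%N ->
  \sum_(e < d.+1 | (e %| d)%N && (f %| e)%N) (moebius (d %/ e))%:~R * P f
    = (f == d :> nat)%:R * P f.
  move=> fd; have f0 := dvd_gt0 _ fd.
  have q0 : (0 < d %/ f)%N by rewrite divn_gt0 // dvdn_leq.
  rewrite -mulr_suml; congr (_ * _).
  have -> : (f == d :> nat) = (d %/ f == 1)%N.
    apply/eqP/eqP => [->|e]; first by rewrite divnn d0.
    by have := divnK fd; rewrite e mul1n.
  have := congr1 (fun z : int => z%:~R : V) (sum_moebius q0).
  rewrite /= rmorph_sum rmorph_nat /= => <-.
  rewrite -(big_mkord (fun e => (e %| d)%N && (f %| e)%N)
    (fun e => (moebius (d %/ e))%:~R : V)) -big_filter.
  rewrite -(big_map (fun e => d %/ e)%N predT (fun e => (moebius e)%:~R : V)).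
  apply: perm_big; apply: uniq_perm; rewrite ?divisors_uniq //.
    rewrite map_inj_in_uniq ?filter_uniq ?iota_uniq // => x y.
    rewrite !mem_filter => /andP[/andP[xd _] _] /andP[/andP[yd _] _] e.
    by rewrite -(divn_divK d0 xd) e divn_divK.
  move=> g; rewrite -dvdn_divisors //; apply/mapP/idP => [[e]|gq].
    rewrite mem_filter => /andP[/andP[ed fe] _] ->.
    by rewrite dvdn_divRL // -[X in (_ %| X)%N](divnK ed) dvdn_mul.
  have gd : (g %| d)%N by apply: dvdn_trans gq (dvdn_div fd).
  exists (d %/ g)%N; last by rewrite divn_divK.
  rewrite mem_filter mem_index_iota dvdn_div //= ltnS leq_div andbT.
  by rewrite dvdn_divRL // mulnC -dvdn_divRL.
rewrite (eq_bigr _ inner) (bigD1 ord_max) //= eqxx mul1r big1 ?addr0 //.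
by move=> f /andP[_ fd]; rewrite (_ : (f == d :> nat) = false) ?mul0r //; apply/negbTE.
Qed.

Theorem theorem5p2 (n d : nat) :
  (1 <= n)%N -> (0 < d)%N -> (d <= n)%N ->
  (#|d_cycles n d|%:R : rat) =
    (d%:R)^-1 * \sum_(e < d.+1 | (e %| d)%N) (moebius (d %/ e))%:~R * ('C(2 * e, e))%:R.
Proof.
move=> _ d0 dn.
have dr : (d%:R : rat) != 0 by rewrite Num.Theory.pnatr_eq0 -lt0n.
apply: (mulfI dr); rewrite mulVKf // mulrC -natrM card_d_cycles //.
rewrite (@sum_divisors_ord _ _ _ (fun e => (moebius (d %/ e))%:~R * ('C(2 * e, e))%:R)) ?d0 ?ltnSn //.
rewrite (@moebius_inversion _ (fun e => ('C(2 * e, e))%:R) (fun e => #|primitive_walks n e|%:R)) // => e ed.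
have e0 := dvdn_gt0 d0 ed.
(* Each divisor [e] of [d] satisfies [e <= d <= n], so the count of closed walks holds for length
   [e] in the same graph. *)
rewrite -(@card_closed_walks n) ?(leq_trans (dvdn_leq d0 ed)) //.
by rewrite card_closed_walks_primitive // natr_sum.
Qed.
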